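(* Let $G$ be a group that is isomorphic to $O^*\ast_{T^*}O^*$. Then $G$ possesses a subgroup that is isomorphic to $$K_2=\langle x,y,a,b\mid x^4=y^2,\ a^4=b^2,\ yxy^{-1}=x^{-1},\ bab^{-1}=a^{-1},\ x^2=b,\ y=a^2b\rangle.$$
   Context: $T^*$ and $O^*$ are the binary tetrahedral group (order $24$) and the binary octahedral group (order $48$). $O^*\ast_{T^*}O^*$ is an amalgamated product in which $T^*$ is embedded as an (index $2$) subgroup of each copy of $O^*$. The group $K_2$ is an amalgamated product of the form $\mathcal{Q}_{16}\ast_{\mathcal{Q}_8}\mathcal{Q}_{16}$ of two copies $\langle x,y\rangle$, $\langle a,b\rangle$ of the generalised quaternion group of order $16$ along the quaternion group of order $8$. *)

(* Defs.v *)
From HB Require Import structures.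
From mathcomp Require Import all_boot all_order all_algebra.
From mathcomp Require Import ring lra.
From mathcomp Require Import boolp classical_sets reals.

Set Implicit Arguments.
Unset Strict Implicit.
Unset Printing Implicit Defensive.

Import Order.TTheory GRing.Theory Num.Theory.

Definition isomorphic (G H : groupType) : Prop :=
  exists f : {multiplicative G -> H}, bijective f.

(* The group operations of the library apply to words, so that group_scope    *)
(* expressions can be used to write relators; words are not reduced.          *)
Inductive word (X : Type) : Type :=
| Gen of X
| One
| Mul of word X & word X
| Inv of word X.

Arguments One {X}.

HB.instance Definition _ (X : Type) := gen_eqMixin (word X).
HB.instance Definition _ (X : Type) := gen_choiceMixin (word X).
HB.instance Definition _ (X : Type) := hasMul.Build (word X) (@Mul X).
HB.instance Definition _ (X : Type) := hasOne.Build (word X) One.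
HB.instance Definition _ (X : Type) := hasInv.Build (word X) (@Inv X).

Section Presentation.
Local Open Scope group_scope.
Local Open Scope quotient_scope.
Variables (X : Type) (rels : set (word X * word X)).

(* A pair (u, v) in rels stands for the relation u = v. *)
Inductive derivable : word X -> word X -> Prop :=
| der_rel u v : rels (u, v) -> derivable u v
| der_refl u : derivable u u
| der_sym u v : derivable u v -> derivable v u
| der_trans u v w : derivable u v -> derivable v w -> derivable u w
| der_mul u u' v v' :
    derivable u u' -> derivable v v' -> derivable (u * v) (u' * v')
| der_inv u u' : derivable u u' -> derivable u^-1 u'^-1
| der_mulA u v w : derivable (u * (v * w)) (u * v * w)
| der_mul1 u : derivable (1 * u) u
| der_mulr1 u : derivable (u * 1) u
| der_mulV u : derivable (u^-1 * u) 1
| der_mulrV u : derivable (u * u^-1) 1.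

Definition derb (u v : word X) : bool := `[< derivable u v >].

Lemma derb_refl : reflexive derb.
Proof. by move=> u; apply/asboolP/der_refl. Qed.

Lemma derb_sym : symmetric derb.
Proof. by move=> u v; apply/asboolP/asboolP; apply: der_sym. Qed.

Lemma derb_trans : transitive derb.
Proof.
by move=> v u w /asboolP uv /asboolP vw; apply/asboolP/(der_trans uv vw).
Qed.

Canonical derb_equiv := EquivRel derb derb_refl derb_sym derb_trans.

Definition presented := {eq_quot derb}.

HB.instance Definition _ := Choice.on presented.

Definition pres_class (u : word X) : presented := \pi_presented u.
Definition pres_gen (x : X) : presented := pres_class (Gen x).

Lemma pres_classP u v : pres_class u = pres_class v <-> derivable u v.
Proof.
by split=> [/eqP|uv]; [|apply/eqP]; rewrite piE => //; [move/asboolP|apply/asboolP].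
Qed.

Lemma pres_reprP u : derivable (repr (pres_class u)) u.
Proof. by apply/pres_classP; rewrite /pres_class reprK. Qed.

Definition pres_mul (g h : presented) := pres_class (repr g * repr h).
Definition pres_inv (g : presented) := pres_class (repr g)^-1.

Lemma pres_mulE u v :
  pres_mul (pres_class u) (pres_class v) = pres_class (u * v).
Proof. by apply/pres_classP; apply: der_mul; apply: pres_reprP. Qed.

Lemma pres_invE u : pres_inv (pres_class u) = pres_class u^-1.
Proof. by apply/pres_classP/der_inv/pres_reprP. Qed.

Lemma pres_ind (P : presented -> Prop) :
  (forall u, P (pres_class u)) -> forall g, P g.
Proof. by move=> Pc g; rewrite -[g]reprK; apply: Pc. Qed.

Lemma pres_mulA : associative pres_mul.
Proof.
elim/pres_ind=> u; elim/pres_ind=> v; elim/pres_ind=> w.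
by rewrite !pres_mulE; apply/pres_classP/der_mulA.
Qed.

Lemma pres_mul1 : left_id (pres_class 1) pres_mul.
Proof.
by elim/pres_ind=> u; rewrite !pres_mulE; apply/pres_classP/der_mul1.
Qed.

Lemma pres_mulr1 : right_id (pres_class 1) pres_mul.
Proof.
by elim/pres_ind=> u; rewrite !pres_mulE; apply/pres_classP/der_mulr1.
Qed.

Lemma pres_mulV : left_inverse (pres_class 1) pres_inv pres_mul.
Proof.
by elim/pres_ind=> u; rewrite pres_invE !pres_mulE; apply/pres_classP/der_mulV.
Qed.

Lemma pres_mulrV : right_inverse (pres_class 1) pres_inv pres_mul.
Proof.
by elim/pres_ind=> u; rewrite pres_invE !pres_mulE; apply/pres_classP/der_mulrV.
Qed.

HB.instance Definition _ := isGroup.Build presented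
  pres_mulA pres_mul1 pres_mulr1 pres_mulV pres_mulrV.

Section UniversalProperty.
Variables (G : groupType) (f : X -> G).

Fixpoint word_eval (u : word X) : G :=
  match u with
  | Gen x => f x
  | One => 1
  | Mul u v => word_eval u * word_eval v
  | Inv u => (word_eval u)^-1
  end.

Hypothesis f_rels : forall u v, rels (u, v) -> word_eval u = word_eval v.

Lemma derivable_eval u v : derivable u v -> word_eval u = word_eval v.
Proof.
elim=> //= [{}u {}v w _ -> _ //|{}u u' {}v v' _ -> _ -> //|{}u u' _ -> //| | | | |].
- by move=> {}u {}v w; rewrite mulgA.
- by move=> {}u; rewrite mul1g.
- by move=> {}u; rewrite mulg1.
- by move=> {}u; rewrite mulVg.
- by move=> {}u; rewrite mulgV.
Qed.

Lemma presented_lift :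
  exists F : {multiplicative presented -> G}, forall x, F (pres_gen x) = f x.
Proof.
pose F (g : presented) := word_eval (repr g).
have FE u : F (pres_class u) = word_eval u by apply/derivable_eval/pres_reprP.
have FM : {morph F : g h / g * h}.
  elim/pres_ind=> u; elim/pres_ind=> v.
  by rewrite [_ * _ in LHS]pres_mulE !FE.
pose FF := HB.pack_for {multiplicative presented -> G} F
  (isMultiplicative.Build _ _ F FM).
by exists FF => x; rewrite [FF _]FE.
Qed.

End UniversalProperty.
End Presentation.

(* The amalgamated product A *_C B of C --i--> A and C --j--> B: generators   *)
(* are the elements of A and B, relations are the two multiplication tables   *)
(* and i c = j c.                                                             *)
Section Amalgam.
Local Open Scope group_scope.
Variables (C A B : groupType) (i : C -> A) (j : C -> B).

Inductive amalgam_rels : word (A + B) * word (A + B) -> Prop :=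
| amalgam_relA (a a' : A) :
    amalgam_rels (Gen (inl (a * a')), Gen (inl a) * Gen (inl a'))
| amalgam_relB (b b' : B) :
    amalgam_rels (Gen (inr (b * b')), Gen (inr b) * Gen (inr b'))
| amalgam_relC (c : C) : amalgam_rels (Gen (inl (i c)), Gen (inr (j c))).

Definition amalgam : groupType := presented amalgam_rels.

End Amalgam.

Inductive K2_gen := K2_x | K2_y | K2_a | K2_b.

Definition K2_rels : set (word K2_gen * word K2_gen) :=
  let x := Gen K2_x in let y := Gen K2_y in
  let a := Gen K2_a in let b := Gen K2_b in
  [set (x ^+ 4, y ^+ 2); (a ^+ 4, b ^+ 2);
       (y * x * y^-1, x^-1); (b * a * b^-1, a^-1);
       (x ^+ 2, b); (y, a ^+ 2 * b)]%classic%g.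

Definition K2 : groupType := presented K2_rels.

Local Open Scope ring_scope.

(* Quat a b c d is the quaternion a + b i + c j + d k. *)
Record quat (R : realType) := Quat { qr : R; qi : R; qj : R; qk : R }.

HB.instance Definition _ (R : realType) := gen_eqMixin (quat R).
HB.instance Definition _ (R : realType) := gen_choiceMixin (quat R).

Section Quaternions.
Variable R : realType.
Implicit Types p q : quat R.

Definition qmul p q : quat R :=
  let: Quat a b c d := p in let: Quat a' b' c' d' := q in
  Quat (a * a' - b * b' - c * c' - d * d')
       (a * b' + b * a' + c * d' - d * c')
       (a * c' - b * d' + c * a' + d * b')
       (a * d' + b * c' - c * b' + d * a').

Definition qconj q : quat R := Quat (qr q) (- qi q) (- qj q) (- qk q).

Definition qnormsq q : R := qr q ^+ 2 + qi q ^+ 2 + qj q ^+ 2 + qk q ^+ 2.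

Definition qcoords q : seq R := [:: qr q; qi q; qj q; qk q].

Definition unit_quat := {q : quat R | qnormsq q == 1}.

HB.instance Definition _ := SubChoice.on unit_quat.

Lemma quat_eq p q : qr p = qr q -> qi p = qi q -> qj p = qj q -> qk p = qk q ->
  p = q.
Proof. by case: p q => [????][????] /= -> -> -> ->. Qed.

Lemma qnormsqM p q : qnormsq (qmul p q) = qnormsq p * qnormsq q.
Proof. by case: p q => [????][????]; rewrite /qnormsq /=; ring. Qed.

Fact unit_quat_mul_subproof (p q : unit_quat) :
  qnormsq (qmul (val p) (val q)) == 1.
Proof. by rewrite qnormsqM (eqP (valP p)) (eqP (valP q)) mulr1. Qed.

Fact unit_quat_one_subproof : qnormsq (Quat 1 0 0 0) == 1.
Proof. by rewrite /qnormsq /= expr1n expr0n /= !addr0. Qed.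

Fact unit_quat_inv_subproof (q : unit_quat) : qnormsq (qconj (val q)) == 1.
Proof. by case: q => q; rewrite /qnormsq /= !sqrrN. Qed.

Definition unit_quat_mul (p q : unit_quat) : unit_quat :=
  Sub (qmul (val p) (val q)) (unit_quat_mul_subproof p q).
Definition unit_quat_one : unit_quat :=
  Sub (Quat 1 0 0 0) unit_quat_one_subproof.
Definition unit_quat_inv (q : unit_quat) : unit_quat :=
  Sub (qconj (val q)) (unit_quat_inv_subproof q).

Lemma unit_quat_mulA : associative unit_quat_mul.
Proof.
case=> [[????]?] [[????]?] [[????]?]; apply/val_inj => /=.
by apply: quat_eq => /=; ring.
Qed.

Lemma unit_quat_mul1 : left_id unit_quat_one unit_quat_mul.
Proof. by case=> [[????]?]; apply/val_inj/quat_eq => /=; ring. Qed.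

Lemma unit_quat_mulr1 : right_id unit_quat_one unit_quat_mul.
Proof. by case=> [[????]?]; apply/val_inj/quat_eq => /=; ring. Qed.

Lemma unit_quat_mulV : left_inverse unit_quat_one unit_quat_inv unit_quat_mul.
Proof.
case=> [[a b c d] n]; apply/val_inj/quat_eq => /=; [|ring..].
by have := eqP n; rewrite /qnormsq /= => <-; ring.
Qed.

Lemma unit_quat_mulrV : right_inverse unit_quat_one unit_quat_inv unit_quat_mul.
Proof.
case=> [[a b c d] n]; apply/val_inj/quat_eq => /=; [|ring..].
by have := eqP n; rewrite /qnormsq /= => <-; ring.
Qed.

HB.instance Definition _ := isGroup.Build unit_quat
  unit_quat_mulA unit_quat_mul1 unit_quat_mulr1 unit_quat_mulV unit_quat_mulrV.

(* Because the norm is 1, the first alternative gives the 8 quaternions       *)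
(* +-1, +-i, +-j, +-k and the second one the 16 quaternions                   *)
(* (+-1 +-i +-j +-k) / 2.                                                     *)
Definition binary_tetrahedral : {pred unit_quat} := fun q : unit_quat =>
  all (fun t => t \in [:: 0; 1; -1]) (qcoords (val q)) ||
  all (fun t => t \in [:: 2^-1; - 2^-1]) (qcoords (val q)).

(* The second alternative gives the 24 quaternions (+-u +-v) / sqrt 2 with    *)
(* u, v distinct in 1, i, j, k.                                               *)
Definition binary_octahedral : {pred unit_quat} := fun q : unit_quat =>
  (q \in binary_tetrahedral) ||
  all (fun t => t \in [:: 0; (Num.sqrt 2)^-1; - (Num.sqrt 2)^-1])
      (qcoords (val q)).

(* Scaled integer coordinates, used to check closure by computation. *)
Definition zquat := (int * int * int * int)%type.

Definition zcoords (n : zquat) : seq int :=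
  let: (a, b, c, d) := n in [:: a; b; c; d].

Definition znorm (n : zquat) : int :=
  let: (a, b, c, d) := n in a * a + b * b + c * c + d * d.

Definition zdiv (m n : zquat) : zquat :=
  let: (a, b, c, d) := m in let: (a', b', c', d') := n in
  (a * a' + b * b' + c * c' + d * d',
   - (a * b') + b * a' - c * d' + d * c',
   - (a * c') + b * d' + c * a' - d * b',
   - (a * d') - b * c' + c * b' + d * a').

Definition zdouble (n : zquat) : zquat :=
  let: (a, b, c, d) := n in (2 * a, 2 * b, 2 * c, 2 * d).

Definition zcast (s : R) (n : zquat) : quat R :=
  let: (a, b, c, d) := n in
  Quat (s * a%:~R) (s * b%:~R) (s * c%:~R) (s * d%:~R).

Definition zrange : seq int := [:: 0; 1; -1; 2; -2].

Definition zall : seq zquat :=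
  [seq (x, d) | x <- [seq (y, c) | y <- [seq (a, b) | a <- zrange, b <- zrange],
                                   c <- zrange], d <- zrange].

Definition ztetra : seq zquat :=
  [seq n <- zall | (znorm n == 4) &&
     (all (fun t => t \in [:: 0; 2; -2]) (zcoords n) ||
      all (fun t => t \in [:: 1; -1]) (zcoords n))].

Definition zocta : seq zquat :=
  [seq n <- zall | (znorm n == 2) &&
     all (fun t => t \in [:: 0; 1; -1]) (zcoords n)].

Lemma mem_zall a b c d : a \in zrange -> b \in zrange -> c \in zrange ->
  d \in zrange -> (a, b, c, d) \in zall.
Proof. by move=> ? ? ? ?; do 3! [apply: allpairs_f => //]. Qed.

Lemma znormE (s : R) n : qnormsq (zcast s n) = s ^+ 2 * (znorm n)%:~R.
Proof.
case: n => [[[a b] c] d]; rewrite /qnormsq /= !rmorphD !rmorphM /=; ring.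
Qed.

Lemma zcast_div (s t : R) m n :
  qmul (zcast s m) (qconj (zcast t n)) = zcast (s * t) (zdiv m n).
Proof.
case: m n => [[[a b] c] d] [[[a' b'] c'] d'].
by apply: quat_eq; rewrite /= ?(rmorphD, rmorphB, rmorphN, rmorphM) /=; ring.
Qed.

Lemma zcast_double (s : R) n : zcast s (zdouble n) = zcast (2 * s) n.
Proof.
by case: n => [[[a b] c] d]; apply: quat_eq; rewrite /= ?rmorphM /=; ring.
Qed.

Lemma zcast_coords (s : R) (ts : seq R) (ns : seq int) (q : quat R) :
    all (fun t => t \in ts) (qcoords q) ->
    (forall t, t \in ts -> exists2 n, n \in ns & t = s * n%:~R) ->
  exists2 n : zquat, all (fun t => t \in ns) (zcoords n) & q = zcast s n.
Proof.
case: q => a b c d /= /and5P[Ta Tb Tc Td _] tsP.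
have [na Na ->] := tsP _ Ta; have [nb Nb ->] := tsP _ Tb.
have [nc Nc ->] := tsP _ Tc; have [nd Nd ->] := tsP _ Td.
by exists (na, nb, nc, nd) => //=; rewrite Na Nb Nc Nd.
Qed.

Lemma zcoords_cast (s : R) (ts : seq R) (ns : seq int) (n : zquat) :
    all (fun t => t \in ns) (zcoords n) ->
    (forall t, t \in ns -> s * t%:~R \in ts) ->
  all (fun t => t \in ts) (qcoords (zcast s n)).
Proof.
case: n => [[[a b] c] d] /= /and5P[Ta Tb Tc Td _] tsP.
by rewrite !tsP.
Qed.

Lemma r2_neq0 : Num.sqrt 2 != 0 :> R.
Proof. by rewrite sqrtr_eq0 -ltNge ltr0n. Qed.

Lemma r2E : Num.sqrt 2 * Num.sqrt 2 = 2 :> R.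
Proof. by rewrite -expr2 sqr_sqrtr // ler0n. Qed.

Lemma zall_sub (ns : seq int) (n : zquat) : {subset ns <= zrange} ->
  all (fun t => t \in ns) (zcoords n) -> n \in zall.
Proof.
case: n => [[[a b] c] d] sub /= /and5P[? ? ? ? _].
by apply: mem_zall; apply: sub.
Qed.

Lemma ztetraP (q : unit_quat) : reflect
  (exists2 n, n \in ztetra & val q = zcast 2^-1 n) (q \in binary_tetrahedral).
Proof.
apply: (iffP orP) => [H|[n]]; last first.
  rewrite mem_filter => /andP[/andP[_ /orP[]] Tn _] ->; [left|right];
    apply: zcoords_cast Tn _ => t; rewrite !inE.
  - by case/or3P=> /eqP->; apply/or3P; [apply: Or31|apply: Or32|apply: Or33];
       apply/eqP; field.
  - by case/orP=> /eqP->; apply/orP; [left|right]; apply/eqP; field.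
suff [n Tn qE]: exists2 n : zquat, (n \in zall) &&
    (all (fun t => t \in [:: 0; 2; -2]) (zcoords n) ||
     all (fun t => t \in [:: 1; -1]) (zcoords n)) & val q = zcast 2^-1 n.
  case/andP: Tn => An Tn.
  exists n => //; rewrite mem_filter An Tn !andbT.
  have := eqP (valP q); rewrite qE znormE => n1.
  have : (znorm n)%:~R = 4 * (2^-1 ^+ 2 * (znorm n)%:~R) :> R by field.
  by rewrite n1 mulr1 -(eqr_int R) => ->.
case: H => H.
- have [|n Tn qE] := zcast_coords (s := 2^-1) (ns := [:: 0; 2; -2]) H.
    move=> t; rewrite !inE => /or3P[] /eqP->.
    + by exists 0; rewrite // mulr0.
    + by exists 2; rewrite //; field.
    + by exists (-2); rewrite //; field.
  exists n => //; rewrite Tn andbT; apply: zall_sub Tn => t.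
  by rewrite !inE => /or3P[] /eqP->.
- have [|n Tn qE] := zcast_coords (s := 2^-1) (ns := [:: 1; -1]) H.
    move=> t; rewrite !inE => /orP[] /eqP->.
    + by exists 1; rewrite // mulr1.
    + by exists (-1); rewrite //; field.
  exists n => //; rewrite Tn orbT andbT; apply: zall_sub Tn => t.
  by rewrite !inE => /orP[] /eqP->.
Qed.

Lemma zoctaP (q : unit_quat) : reflect
  ((exists2 n, n \in ztetra & val q = zcast 2^-1 n) \/
   (exists2 n, n \in zocta & val q = zcast (Num.sqrt 2)^-1 n))
  (q \in binary_octahedral).
Proof.
apply: (iffP orP) => -[/ztetraP Tq|H]; [by left| |by left|].
- right; have [|n Tn qE] := zcast_coords (s := (Num.sqrt 2)^-1)
      (ns := [:: 0; 1; -1]) H.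
    move=> t; rewrite !inE => /or3P[] /eqP->.
    + by exists 0; rewrite // mulr0.
    + by exists 1; rewrite // mulr1.
    + by exists (-1); rewrite // mulrN1.
  exists n => //; rewrite mem_filter Tn andbT.
  rewrite (zall_sub _ Tn) ?andbT => [|t]; last by rewrite !inE => /or3P[]/eqP->.
  have := eqP (valP q); rewrite qE znormE => n1.
  have : (znorm n)%:~R = 2 * ((Num.sqrt 2)^-1 ^+ 2 * (znorm n)%:~R) :> R.
    by rewrite -[X in X * _]r2E; field; apply: r2_neq0.
  by rewrite n1 mulr1 -(eqr_int R) => ->.
- right; case: H => n; rewrite mem_filter => /andP[/andP[_ Tn] _] ->.
  apply: zcoords_cast Tn _ => t; rewrite !inE.
  by case/or3P=> /eqP->; rewrite ?mulr0 ?mulr1 ?mulrN1 ?eqxx ?orbT.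
Qed.

Lemma zTT : all (fun m => all (fun n =>
  has (fun r => zdiv m n == zdouble r) ztetra) ztetra) ztetra.
Proof. by vm_compute. Qed.

Lemma zTO : all (fun m => all (fun n =>
  has (fun r => zdiv m n == zdouble r) zocta) zocta) ztetra.
Proof. by vm_compute. Qed.

Lemma zOT : all (fun m => all (fun n =>
  has (fun r => zdiv m n == zdouble r) zocta) ztetra) zocta.
Proof. by vm_compute. Qed.

Lemma zOO : all (fun m => all (fun n => zdiv m n \in ztetra) zocta) zocta.
Proof. by vm_compute. Qed.

Lemma zTT_div m n : m \in ztetra -> n \in ztetra -> exists2 r, r \in ztetra &
  qmul (zcast 2^-1 m) (qconj (zcast 2^-1 n)) = zcast 2^-1 r.
Proof.
move=> /(allP zTT)/allP mn /mn/hasP[r Tr /eqP E]; exists r => //.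
by rewrite zcast_div E zcast_double; congr zcast; field.
Qed.

Lemma binary_tetrahedral_closed : group_closed binary_tetrahedral.
Proof.
split=> [|p q /ztetraP[m Tm pE] /ztetraP[n Tn qE]].
  by apply/orP; left; rewrite /= !inE !eqxx !orbT.
apply/ztetraP; have [r Tr E] := zTT_div Tm Tn.
by exists r; rewrite // -E -pE -qE.
Qed.

Lemma binary_octahedral_closed : group_closed binary_octahedral.
Proof.
split=> [|p q]; first by apply/orP; left; case: binary_tetrahedral_closed.
case/zoctaP=> -[m Tm pE] /zoctaP[] [n Tn qE]; apply/zoctaP.
- have [r Tr E] := zTT_div Tm Tn.
  by left; exists r; rewrite // -E -pE -qE.
- have /hasP[r Tr /eqP E] := allP (allP zTO _ Tm) _ Tn; right; exists r => //.
  have -> : val (p / q)%g = qmul (val p) (qconj (val q)) by [].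
  by rewrite pE qE zcast_div E zcast_double; congr zcast; field; apply: r2_neq0.
- have /hasP[r Tr /eqP E] := allP (allP zOT _ Tm) _ Tn; right; exists r => //.
  have -> : val (p / q)%g = qmul (val p) (qconj (val q)) by [].
  by rewrite pE qE zcast_div E zcast_double; congr zcast; field; apply: r2_neq0.
- left; exists (zdiv m n); first exact: (allP (allP zOO _ Tm) _ Tn).
  have -> : val (p / q)%g = qmul (val p) (qconj (val q)) by [].
  by rewrite pE qE zcast_div; congr zcast; rewrite -invfM r2E.
Qed.

Definition Tstar := {q : unit_quat | q \in binary_tetrahedral}.
Definition Ostar := {q : unit_quat | q \in binary_octahedral}.

HB.instance Definition _ := SubChoice.on Tstar.
HB.instance Definition _ := SubChoice.on Ostar.
HB.instance Definition _ := SubChoice_isSubGroup.Build unit_quat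
  (fun q : unit_quat => q \in binary_tetrahedral) Tstar binary_tetrahedral_closed.
HB.instance Definition _ := SubChoice_isSubGroup.Build unit_quat
  (fun q : unit_quat => q \in binary_octahedral) Ostar binary_octahedral_closed.

End Quaternions.

(* Main.v *)
Require Import Defs.
From HB Require Import structures.
From mathcomp Require Import all_boot all_order all_algebra.
From mathcomp Require Import reals.
From mathcomp Require Import boolp classical_sets.
From mathcomp Require Import zify ring lra.

(** Write T and O for the binary tetrahedral and octahedral groups.  K2 is
    itself an amalgam of two copies of Q16 along Q8: the relations say that x and y
    generate one copy of Q16, that a and b generate another, and that the
    subgroups Q8 generated by x^2 and y, and by a^2 and b, are identified.  To
    embed K2 in an amalgam of two copies of O along T, given by embeddings i and
    j, it is enough to find the two copies of Q16 inside the two copies of O,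
    both meeting T exactly in the same Q8.

    Let p and r be two anticommuting imaginary units in T.  In the first factor
    u = i(p) satisfies u^2 = -1 and lies in T, so u is an imaginary unit up to
    sign and X = (1 + u) / sqrt 2 is a square root of u in O but not in T; every
    element that inverts u under conjugation also inverts X ([octa_sqrt]).
    The same lemma in the second factor gives a square root W of j(r p^-1).
    Sending x, y, a, b to X, i(r), W, i(p) respects the relations of K2
    ([K2_image_rels]).

    Injectivity uses that T has index 2, which replaces the normal form
    theorem for amalgams.
    - Since Q8 is normalised by x and a, every element of K2 is an alternating
      word in x and a followed by an element of Q8 ([K2_normal_form]).
    - The sign character O -> O/T kills the image of every homomorphism
      T -> O, because the elements of T are quotients of two squares
      ([Tstar_image]).  So the amalgam acts on the integers, each factor
      through its sign and one of the reflections n |-> -1 - n and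
      n |-> 1 - n.  An alternating word of length n moves 0 to n or -n, so an
      element of the kernel of K2 -> amalgam lies in Q8.
    - Q8 embeds, because the factors of an amalgam embed in it
      ([amalgam_inl_inj]); this is shown by letting the amalgam act on the
      product of C with a transversal of C in A and one of C in B. *)

Set Implicit Arguments.
Unset Strict Implicit.
Unset Printing Implicit Defensive.

Import GRing.Theory.

Local Open Scope group_scope.

(** * Morphisms of groups *)

Definition morphism_of (G H : groupType) (f : G -> H)
    (fM : {morph f : x y / x * y}) : {multiplicative G -> H} :=
  HB.pack_for {multiplicative G -> H} f (isMultiplicative.Build G H f fM).

Section GroupMorphism.
Variables (G H : groupType) (f : {multiplicative G -> H}).

Lemma hom1 : f 1 = 1.
Proof. by apply: (mulgI (f 1)); rewrite -gmulfM !mulg1. Qed.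

Lemma homV x : f x^-1 = (f x)^-1.
Proof. by apply/esym/mulg1_eq; rewrite -gmulfM mulgV hom1. Qed.

Lemma homX n x : f (x ^+ n) = f x ^+ n.
Proof. by elim: n => [|n IHn]; rewrite ?hom1 // !expgS gmulfM IHn. Qed.

Lemma hom_inj : (forall x, f x = 1 -> x = 1) -> injective f.
Proof.
by move=> f1 x y fxy; apply/divg1_eq/f1; rewrite gmulfM homV fxy mulgV.
Qed.

End GroupMorphism.

(** * Bijections of a type *)

Record sym (E : Type) := Sym {
  sym_fun :> E -> E; sym_inv : E -> E;
  sym_funK : cancel sym_fun sym_inv; sym_invK : cancel sym_inv sym_fun }.

HB.instance Definition _ E := gen_eqMixin (sym E).
HB.instance Definition _ E := gen_choiceMixin (sym E).

Section SymGroup.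
Variable E : Type.
Implicit Types s t : sym E.

Lemma sym_ext s t : s =1 t -> s = t.
Proof.
case: s t => f f' fK f'K [g g' gK g'K] /= fg.
have /funext Ef := fg; subst g.
have Ef' : f' = g' by apply/funext => x; rewrite -{1}[x]g'K fK.
by subst g'; congr Sym; apply: Prop_irrelevance.
Qed.

Definition sym_mul s t : sym E :=
  Sym (can_comp (@sym_funK _ s) (@sym_funK _ t))
      (can_comp (@sym_invK _ t) (@sym_invK _ s)).
Definition sym_one : sym E := @Sym E id id (frefl _) (frefl _).
Definition sym_opp s : sym E := Sym (@sym_invK _ s) (@sym_funK _ s).

Lemma sym_mulA : associative sym_mul.
Proof. by move=> s t u; apply: sym_ext. Qed.
Lemma sym_mul1 : left_id sym_one sym_mul.
Proof. by move=> s; apply: sym_ext. Qed.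
Lemma sym_mulr1 : right_id sym_one sym_mul.
Proof. by move=> s; apply: sym_ext. Qed.
Lemma sym_mulV : left_inverse sym_one sym_opp sym_mul.
Proof. by move=> s; apply: sym_ext => x /=; rewrite sym_funK. Qed.
Lemma sym_mulrV : right_inverse sym_one sym_opp sym_mul.
Proof. by move=> s; apply: sym_ext => x /=; rewrite sym_invK. Qed.

HB.instance Definition _ := isGroup.Build (sym E)
  sym_mulA sym_mul1 sym_mulr1 sym_mulV sym_mulrV.

Lemma symM s t x : (s * t) x = s (t x). Proof. by []. Qed.

End SymGroup.

(** * Presented groups and amalgams *)

Section Presented.
Variables (X : Type) (rels : set (word X * word X)).
Notation P := (presented rels).

Lemma pres_classM u v :
  pres_class rels (u * v) = pres_class rels u * pres_class rels v.
Proof. by rewrite -pres_mulE. Qed.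

Lemma pres_classV u : pres_class rels u^-1 = (pres_class rels u)^-1.
Proof. by rewrite -pres_invE. Qed.

Lemma pres_classX u n : pres_class rels (u ^+ n.+1) = pres_class rels u ^+ n.+1.
Proof.
elim: n => [|n IHn]; first by rewrite !expg1.
by rewrite expgSS [in RHS]expgSS pres_classM IHn.
Qed.

(** The induction on a word [u] has to treat left multiplication by [u] and by
    its inverse at the same time, because the two are exchanged by [Inv]. *)
Lemma presented_left_ind (Q : P -> Prop) :
    Q 1 -> (forall x g, Q g -> Q (pres_gen rels x * g)) ->
    (forall x g, Q g -> Q ((pres_gen rels x)^-1 * g)) ->
  forall g, Q g.
Proof.
move=> Q1 QM QV.
suff H u : forall g, Q g -> Q (pres_class rels u * g) /\
                            Q ((pres_class rels u)^-1 * g).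
  by elim/pres_ind=> u; rewrite -[pres_class _ u]mulg1; apply: (H u 1 Q1).1.
elim: u => [x|| u IHu v IHv | u IHu] g Qg.
- by split; [apply: QM | apply: QV].
- by rewrite invg1 mul1g.
- rewrite [Mul u v](_ : _ = u * v) // pres_classM invgM -!mulgA.
  by split; [apply: (IHu _ _).1; apply: (IHv _ _).1
            |apply: (IHv _ _).2; apply: (IHu _ _).2].
- rewrite [Inv u](_ : _ = u^-1) // pres_classV invgK.
  by have [? ?] := IHu _ Qg.
Qed.

End Presented.

Section AmalgamMaps.
Variables (C A B : groupType).
Variables (i : {multiplicative C -> A}) (j : {multiplicative C -> B}).

Lemma amalgam_inl_morph :
  {morph (fun a => pres_gen (amalgam_rels i j) (inl a) : amalgam i j)
    : x y / x * y}.
Proof.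
by move=> x y; rewrite -pres_classM; apply/pres_classP/der_rel/amalgam_relA.
Qed.

Lemma amalgam_inr_morph :
  {morph (fun b => pres_gen (amalgam_rels i j) (inr b) : amalgam i j)
    : x y / x * y}.
Proof.
by move=> x y; rewrite -pres_classM; apply/pres_classP/der_rel/amalgam_relB.
Qed.

Definition amalgam_inl := morphism_of amalgam_inl_morph.
Definition amalgam_inr := morphism_of amalgam_inr_morph.

Lemma amalgam_glue c : amalgam_inl (i c) = amalgam_inr (j c).
Proof. by apply/pres_classP/der_rel/amalgam_relC. Qed.

Lemma amalgam_lift (H : groupType) (f : {multiplicative A -> H})
    (g : {multiplicative B -> H}) : (forall c, f (i c) = g (j c)) ->
  exists F : {multiplicative amalgam i j -> H},
    (forall a, F (amalgam_inl a) = f a) /\ (forall b, F (amalgam_inr b) = g b).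
Proof.
move=> fg; pose h (x : A + B) := match x with inl a => f a | inr b => g b end.
have h_rels u v : amalgam_rels i j (u, v) -> word_eval h u = word_eval h v.
  suff P w : amalgam_rels i j w -> word_eval h w.1 = word_eval h w.2 by move/P.
  by case=> * /=; rewrite ?gmulfM.
have [F FE] := presented_lift h_rels.
by exists F; split=> x; apply: FE.
Qed.

End AmalgamMaps.

(** * Embedding of the factors *)

Section Transversal.
Variables (C A : groupType) (i : {multiplicative C -> A}).
Hypothesis i_inj : injective i.

(** Choosing a representative in each coset of the image of C turns A into C
    times a transversal, on which C acts by left translation only. *)
Lemma left_translation_free : exists (T : Type) (e : A -> C * T),
  bijective e /\ forall c a, e (i c * a) = (c * (e a).1, (e a).2).
Proof.
pose orb a : set A := fun r => exists c, r = i c * a.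
pose rho a := xget 1 (orb a).
have rhoP a : exists c, rho a = i c * a.
  by apply: (@xgetPex _ 1 (orb a)); exists a, 1; rewrite hom1 mul1g.
have rhoM c a : rho (i c * a) = rho a.
  congr xget; apply/funext => r; apply/propext; split=> -[d ->].
    by exists (d * c); rewrite gmulfM mulgA.
  by exists (d / c); rewrite gmulfM homV mulgA mulgVK.
have rhoK a : rho (rho a) == rho a.
  by have [c E] := rhoP a; rewrite [X in rho X]E rhoM.
have /choice[gam gamP] : forall a, exists c, a = i c * rho a.
  by move=> a; have [c ->] := rhoP a; exists c^-1; rewrite homV mulKg.
pose T := {r : A | rho r == r}.
pose e a : C * T := (gam a, exist _ (rho a) (rhoK a)).
exists T, e; split=> [|c a].
- exists (fun ct => i ct.1 * val ct.2) => [a|[c [r rK]]] /=.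
    by rewrite -gamP.
  have rE := eqP rK; have E : rho (i c * r) = r by rewrite rhoM.
  congr (_, _); last exact/val_inj.
  by apply/i_inj/(mulIg r); rewrite -{2}E -gamP.
- congr (_, _); last by apply/val_inj; rewrite /= rhoM.
  apply/i_inj/(mulIg (rho a)).
  by rewrite -{1}(rhoM c a) -gamP gmulfM -mulgA -gamP.
Qed.

End Transversal.

Lemma translation_action (A : groupType) (S E : Type) (e : A * S -> E) :
    bijective e ->
  exists f : {multiplicative A -> sym E},
    forall a b s, f a (e (b, s)) = e (a * b, s).
Proof.
case=> e' eK e'K.
pose act a x := e (a * (e' x).1, (e' x).2).
have actK a : cancel (act a) (act a^-1).
  by move=> x; rewrite /act eK mulKg -surjective_pairing e'K.
have actVK a : cancel (act a^-1) (act a).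
  by move=> x; rewrite /act eK mulVKg -surjective_pairing e'K.
have fM : {morph (fun a => Sym (actK a) (actVK a)) : a b / a * b}.
  by move=> a b; apply: sym_ext => x; rewrite symM /= /act eK mulgA.
by exists (morphism_of fM) => a b s /=; rewrite /act eK.
Qed.

Section Embedding.
Variables (C A B : groupType).
Variables (i : {multiplicative C -> A}) (j : {multiplicative C -> B}).
Hypotheses (i_inj : injective i) (j_inj : injective j).

(** A is C times a transversal TA, and B is C times a transversal TB, so A * TB
    and B * TA are both C * TA * TB as sets with an action of C.  Left
    translations of A and of B thus glue to an action of the amalgam, and A acts
    faithfully on A * TB. *)
Theorem amalgam_inl_inj : injective (amalgam_inl i j).
Proof.
have [TA [eA [[eA' eAK eA'K] eAM]]] := left_translation_free i_inj.
have [TB [eB [[eB' eBK eB'K] eBM]]] := left_translation_free j_inj.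
pose hA (x : A * TB) : C * TA * TB := (eA x.1, x.2).
pose hB (x : B * TA) : C * TA * TB := ((eB x.1).1, x.2, (eB x.1).2).
have hA_bij : bijective hA.
  exists (fun y => (eA' y.1, y.2)) => [[a t]|[[c s] t]]; rewrite /hA /= ?eAK //.
  by rewrite eA'K.
have hB_bij : bijective hB.
  exists (fun y => (eB' (y.1.1, y.2), y.1.2)) => [[b t]|[[c s] t]];
    rewrite /hB /= -?surjective_pairing ?eBK //.
  by rewrite eB'K.
have [f fE] := translation_action hA_bij.
have [g gE] := translation_action hB_bij.
have fg c : f (i c) = g (j c).
  apply: sym_ext => -[[d s] t].
  have -> : (d, s, t) = hA (eA' (d, s), t) by rewrite /hA /= eA'K.
  rewrite fE {1}/hA /= eAM eA'K /=.
  have -> : hA (eA' (d, s), t) = hB (eB' (d, t), s).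
    by rewrite /hA /hB /= eA'K eB'K.
  by rewrite gE /hB /= eBM eB'K.
have [F [FA _]] := amalgam_lift fg.
apply: hom_inj => a Fa1.
(* A point of TB, to have an element of A * TB on which a acts. *)
have [t _] : TB * unit by exact: ((eB 1).2, tt).
have := fE a 1 t; rewrite -FA Fa1 hom1 => /(bij_inj hA_bij).
by case; rewrite mulg1.
Qed.

End Embedding.

(** * Normal forms in K2 *)

Section K2NormalForm.

Notation gen := (pres_gen K2_rels).
Notation x := (gen K2_x : K2).
Notation y := (gen K2_y : K2).
Notation a := (gen K2_a : K2).
Notation b := (gen K2_b : K2).

Lemma K2_relE u v : K2_rels (u, v) ->
  pres_class K2_rels u = pres_class K2_rels v.
Proof. by move=> uv; apply/pres_classP/der_rel. Qed.

Lemma K2_x4 : x ^+ 4 = y ^+ 2.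
Proof.
rewrite -!pres_classX; apply: K2_relE.
by do 5?left; exact: erefl.
Qed.

Lemma K2_xJy : x ^ y^-1 = x^-1.
Proof.
have /K2_relE : K2_rels (Gen K2_y * Gen K2_x * (Gen K2_y)^-1, (Gen K2_x)^-1).
  by left; left; left; right; exact: erefl.
by rewrite !(pres_classM, pres_classV) conjgE invgK -mulgA.
Qed.

Lemma K2_aJb : a ^ b^-1 = a^-1.
Proof.
have /K2_relE : K2_rels (Gen K2_b * Gen K2_a * (Gen K2_b)^-1, (Gen K2_a)^-1).
  by left; left; right; exact: erefl.
by rewrite !(pres_classM, pres_classV) conjgE invgK -mulgA.
Qed.

Lemma K2_x2 : x * x = b.
Proof.
have /K2_relE : K2_rels (Gen K2_x ^+ 2, Gen K2_b) by left; right; exact: erefl.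
by rewrite pres_classX expg2.
Qed.

Lemma K2_yE : y = a * a * b.
Proof.
have /K2_relE : K2_rels (Gen K2_y, Gen K2_a ^+ 2 * Gen K2_b).
  by right; exact: erefl.
by rewrite pres_classM pres_classX expg2.
Qed.

Lemma K2_b2 : b * b = y * y.
Proof. by rewrite -!expg2 -K2_x4 -K2_x2 -expg2 -expgnA. Qed.

Lemma K2_bJy : b ^ y^-1 = b^-1.
Proof. by rewrite -K2_x2 conjMg K2_xJy invgM. Qed.

(** Conjugation by y fixes b^2 = y^2 and, inverting b, also inverts it. *)
Lemma K2_b4 : b ^+ 4 = 1.
Proof.
have: (b * b) ^ y^-1 = b * b by rewrite K2_b2 conjgE invgK mulgK.
rewrite conjMg K2_bJy => b2.
by rewrite !expgSS expg1 mulgA -{1}b2 -mulgA mulKg mulVg.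
Qed.

Lemma K2_bV : b^-1 = b ^+ 3.
Proof. by apply: mulg1_eq; rewrite -expgS K2_b4. Qed.

Lemma K2_yb : y * b = b ^+ 3 * y.
Proof. by rewrite -K2_bV -K2_bJy conjgE invgK -!mulgA mulVg mulg1. Qed.

(** The image of the quaternion group of order 8, along which the two copies
    of the generalised quaternion group of order 16 are glued. *)
Definition in_Q8 (g : K2) := exists m n, g = b ^+ m * y ^+ n.

Lemma in_Q8_b : in_Q8 b.
Proof. by exists 1%N, 0%N; rewrite mulg1. Qed.

Lemma in_Q8_y : in_Q8 y.
Proof. by exists 0%N, 1%N; rewrite mul1g. Qed.

Lemma in_Q8_1 : in_Q8 1.
Proof. by exists 0%N, 0%N; rewrite mul1g. Qed.

Lemma in_Q8M g h : in_Q8 g -> in_Q8 h -> in_Q8 (g * h).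
Proof.
have yb n m : y ^+ n * b ^+ m = b ^+ (m * 3 ^ n) * y ^+ n.
  elim: n => [|n IHn] in m *; first by rewrite mul1g mulg1 muln1.
  have y1b k : y * b ^+ k = b ^+ (k * 3) * y.
    elim: k => [|k IHk]; first by rewrite mul1g mulg1.
    by rewrite expgS mulgA K2_yb -mulgA IHk mulgA -expgnDr.
  by rewrite expgS -mulgA IHn mulgA y1b -mulgA expnSr mulnA.
move=> [m [n ->]] [m' [n' ->]]; exists (m + m' * 3 ^ n)%N, (n + n')%N.
by rewrite !expgnDr -!mulgA; congr (_ * _); rewrite !mulgA yb.
Qed.

Lemma in_Q8X g n : in_Q8 g -> in_Q8 (g ^+ n).
Proof.
move=> Qg; elim: n => [|n IHn]; first exact: in_Q8_1.
by rewrite expgS; apply: in_Q8M.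
Qed.

Lemma in_Q8V g : in_Q8 g -> in_Q8 g^-1.
Proof.
case=> m [n ->]; rewrite invgM -!expVgn.
have -> : y^-1 = y ^+ 3.
  by apply: mulg1_eq; rewrite -expgS (expgnA y 2 2) (expg2 y) -K2_b2 -expg2
    -expgnA K2_b4.
rewrite K2_bV; apply: in_Q8M; do 2!apply: in_Q8X.
  exact: in_Q8_y.
exact: in_Q8_b.
Qed.

(** The two letters whose alternating products represent the cosets of Q8. *)
Definition letter (s : bool) : K2 := if s then x else a.

Lemma letter_sqr s : in_Q8 (letter s * letter s).
Proof.
case: s => /=; first by rewrite K2_x2; apply: in_Q8_b.
have -> : a * a = y * b^-1 by rewrite K2_yE mulgK.
by apply/in_Q8M/in_Q8V/in_Q8_b/in_Q8_y.
Qed.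

Lemma in_Q8J s g : in_Q8 g -> in_Q8 (g ^ letter s).
Proof.
suff [Qb Qy] : in_Q8 (b ^ letter s) /\ in_Q8 (y ^ letter s).
  by case=> m [n ->]; rewrite conjMg !conjXg; apply: in_Q8M; apply: in_Q8X.
case: s => /=.
- have -> : b ^ x = b by rewrite -K2_x2 conjgE -mulgA mulKg.
  have -> : y ^ x = y * b.
    have xy : x^-1 * y = y * x.
      by rewrite -K2_xJy conjgE invgK -!mulgA mulVg mulg1.
    by rewrite conjgE mulgA xy -K2_x2 -mulgA.
  by split; [exact: in_Q8_b | exact: in_Q8M in_Q8_y in_Q8_b].
- have ba : b * a = a^-1 * b.
    by rewrite -K2_aJb conjgE invgK -!mulgA mulVg mulg1.
  have -> : b ^ a = (a * a)^-1 * b by rewrite conjgE ba mulgA invgM.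
  have -> : y ^ a = b by rewrite K2_yE conjgE -!mulgA mulKg ba mulVKg.
  split; last exact: in_Q8_b.
  exact: in_Q8M (in_Q8V (letter_sqr false)) in_Q8_b.
Qed.

Fixpoint alternating (s : bool) (n : nat) : K2 :=
  if n is n'.+1 then letter s * alternating (~~ s) n' else 1.

(** Q8 is normalised by both letters, so it can be moved across any word. *)
Lemma in_Q8_alternating q s n : in_Q8 q ->
  exists2 q', in_Q8 q' & q * alternating s n = alternating s n * q'.
Proof.
elim: n => [|n IHn] /= in s q *; first by exists q; rewrite ?mul1g ?mulg1.
move=> Qq; have [q' Qq' E] := IHn (~~ s) _ (in_Q8J s Qq).
by exists q'; rewrite // mulgA (conjgC q) -mulgA E mulgA.
Qed.

Definition normal_form (g : K2) :=
  exists s n q, in_Q8 q /\ g = alternating s n * q.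

Lemma normal_form_Q8 q g : in_Q8 q -> normal_form g -> normal_form (q * g).
Proof.
move=> Qq [s [n [r [Qr ->]]]]; have [q' Qq' E] := in_Q8_alternating s n Qq.
by exists s, n, (q' * r); split; [exact: in_Q8M | rewrite mulgA E mulgA].
Qed.

Lemma normal_form_letter s g : normal_form g -> normal_form (letter s * g).
Proof.
case=> t [[|n] [q [Qq ->]]].
  by exists s, 1%N, q; split; rewrite //= mulg1 mul1g.
have [<-|] := eqVneq s t; last first.
  by move=> /negPf st; exists s, n.+2, q; split=> //=; case: s t st => -[] //=;
    rewrite !mulgA.
rewrite /= !mulgA -mulgA; apply: normal_form_Q8; first exact: letter_sqr.
by exists (~~ s), n, q.
Qed.

(** Multiplying an alternating word on the left by a letter either lengthens it
    or produces the square of a letter, which lies in Q8; the inverse of a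
    letter differs from the letter by such a square. *)
Lemma K2_normal_form g : normal_form g.
Proof.
elim/presented_left_ind: g => [|z g NFg|z g NFg].
- by exists true, 0%N, 1; split; [exact: in_Q8_1 | rewrite mul1g].
- case: z; [exact: (@normal_form_letter true)| |
            exact: (@normal_form_letter false)|]; apply: normal_form_Q8 => //;
  [exact: in_Q8_y | exact: in_Q8_b].
- have NFV s : normal_form ((letter s)^-1 * g).
    have -> : (letter s)^-1 = letter s * (letter s * letter s)^-1.
      by rewrite invgM mulVKg.
    rewrite -mulgA; apply/normal_form_letter/normal_form_Q8 => //.
    exact/in_Q8V/letter_sqr.
  case: z; [exact: (NFV true)| |exact: (NFV false)|];
    apply: normal_form_Q8 => //; apply: in_Q8V;
    [exact: in_Q8_y | exact: in_Q8_b].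
Qed.

End K2NormalForm.

(** * Embedding K2 by means of an action on the integers *)

Lemma reflectionK (c : int) : involutive (fun n : int => c - n)%R.
Proof. by move=> n; ring. Qed.

Definition reflection (c : int) : sym int :=
  Sym (reflectionK c) (reflectionK c).

Lemma reflection_sqr c : reflection c * reflection c = 1.
Proof. by apply: sym_ext => n; rewrite symM /= reflectionK. Qed.

(** With p and r in the roles of the quaternions i and j, r / p is k. *)
Lemma quaternion_third_sqr (C : groupType) (p r : C) :
  r * r = p * p -> p ^ r^-1 = p^-1 -> r / p * (r / p) = p * p.
Proof.
move=> r2 pJr.
have rp : r * p = p^-1 * r by rewrite -pJr conjgE invgK -!mulgA mulVg mulg1.
have rpV : r * p^-1 = p * r.
  by apply: (mulIg p); rewrite mulgVK -mulgA rp mulVKg.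
by rewrite {1}rpV -mulgA [r * (_ * _)]mulgA r2 -!mulgA mulgV mulg1.
Qed.

Section K2Embedding.
Variables (C A B H : groupType).
Variables (i : {multiplicative C -> A}) (j : {multiplicative C -> B}).
Variables (hA : {multiplicative A -> H}) (hB : {multiplicative B -> H}).
Hypothesis glue : forall c, hA (i c) = hB (j c).

Variables p r : C.
Hypotheses (p2 : p * p <> 1) (p4 : p ^+ 4 = 1) (r2 : r * r = p * p).
Hypothesis pJr : p ^ r^-1 = p^-1.

Variables (X : A) (W : B).
Hypotheses (X2 : X * X = i p) (XJ : X ^ (i r)^-1 = X^-1).
Hypotheses (W2 : W * W = j (r * p^-1)) (WJ : W ^ (j p)^-1 = W^-1).

(** The relation y = a^2 b forces the square of the image of a to be r / p. *)
Definition K2_image (g : K2_gen) : H :=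
  match g with
  | K2_x => hA X | K2_y => hA (i r)
  | K2_a => hB W | K2_b => hA (i p)
  end.

Lemma K2_image_rels u v :
  K2_rels (u, v) -> word_eval K2_image u = word_eval K2_image v.
Proof.
have k2 := quaternion_third_sqr r2 pJr.
have ev w n : word_eval K2_image (w ^+ n.+1) = word_eval K2_image w ^+ n.+1.
  elim: n => [|n IHn]; first by [].
  by rewrite expgSS [in RHS]expgSS /= IHn.
case=> [[[[[]|]|]|]|] [-> ->]; rewrite ?ev /= ?ev /=.
- by rewrite (expgnA _ 2 2) -!homX (expg2 X) X2 -!homX !expg2 r2.
- by rewrite (expgnA _ 2 2) glue -!homX (expg2 W) W2 -!homX !expg2 k2.
- by rewrite -[in RHS]homV -XJ conjgE invgK !gmulfM homV mulgA.
- by rewrite glue -[in RHS]homV -WJ conjgE invgK !gmulfM homV mulgA.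
- by rewrite expg2 -gmulfM X2.
- by rewrite !glue -!gmulfM W2 -gmulfM mulgVK.
Qed.

Hypothesis hAi_inj : injective (hA \o i).
Variable D : {multiplicative H -> sym int}.
Hypothesis Di : forall c, D (hA (i c)) = 1.
Hypotheses (DX : D (hA X) = reflection (-1)%R).
Hypotheses (DW : D (hB W) = reflection 1%R).

(** A word of positive length is detected by the action on the integers, and an
    element of Q8 by its image in C.  The two reflections have been chosen so
    that 0 is fixed by neither and has a free orbit. *)
Theorem K2_embeds : exists F : {multiplicative K2 -> H}, injective F.
Proof.
have [F FE] := presented_lift K2_image_rels; exists F.
have DQ q : in_Q8 q -> D (F q) = 1.
  case=> m [n ->]; rewrite gmulfM !homX !FE /= gmulfM !homX !Di.
  by rewrite !expg1n mulg1.
have Dalt s n : D (F (alternating s n)) 0%R = (if s then - n%:Z else n%:Z)%R.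
  elim: n => [|n IHn] /= in s *; first by rewrite !hom1 /=; case: s.
  rewrite !gmulfM symM IHn.
  by case: s => /=; rewrite FE /= ?DX ?DW /=; lia.
apply: hom_inj => g Fg1.
have [s [n [q [Qq gE]]]] := K2_normal_form g.
have n0 : n = 0%N.
  have := congr1 (fun h => D h 0%R) Fg1.
  by rewrite gE !gmulfM (DQ q) // mulg1 Dalt hom1 /=; case: s {gE} => /=; lia.
move: Fg1; rewrite gE n0 /= mul1g; case: Qq => m [k ->].
(* Both in C and in K2 the square of the second generator is absorbed by the
   powers of the first one. *)
have red (K : groupType) (b y : K) : b * b = y * y ->
    b ^+ m * y ^+ k = b ^+ (m + 2 * k./2) * y ^+ odd k.
  move=> by2; rewrite expgnDr -mulgA (expgnA b 2) (expg2 b) by2 -expg2 -expgnA.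
  by rewrite -expgnDr mul2n addnC odd_double_half.
rewrite gmulfM !homX !FE /= -!homX -!gmulfM.
rewrite (red _ _ _ K2_b2) (red _ _ _ (esym r2)).
set M := (m + _)%N => E.
have {E} : p ^+ M * r ^+ odd k = 1 by apply/hAi_inj; rewrite /= E !hom1.
case: (odd k) => [pr|]; last first.
  have mod4 (K : groupType) (b : K) : b ^+ 4 = 1 -> b ^+ M = b ^+ (M %% 4).
    move=> b4; rewrite {1}(divn_eq M 4) mulnC expgnDr expgnA b4.
    by rewrite expg1n mul1g.
  rewrite !mulg1 (mod4 _ _ K2_b4) (mod4 _ _ p4).
  have := ltn_pmod M (isT : 0 < 4)%N.
  case: (M %% 4)%N => [|[|[|[|//]]]] _ // pM; case: p2; rewrite ?expg1 in pM.
  - by rewrite pM mulg1.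
  - by move: p4; rewrite expgSr pM mul1g => ->; rewrite mulg1.
(* Otherwise r is a power of p, so it centralises p, which it also inverts. *)
have rE : r^-1 = p ^+ M.
  by apply/esym; rewrite -[LHS]mulg1 -(mulgV r) mulgA pr mul1g.
case: p2; have := pJr; rewrite rE conjgE.
have -> : p * p ^+ M = p ^+ M * p by rewrite -expgS -expgSr.
by rewrite mulKg => {1}->; rewrite mulVg.
Qed.

End K2Embedding.

(** * The binary octahedral group *)

Section Octahedral.
Variable R : realType.
Notation inT := (@binary_tetrahedral R).

HB.instance Definition _ := isMulClosed.Build _ (@binary_tetrahedral R)
  (group_closedM (@binary_tetrahedral_closed R)).
HB.instance Definition _ := isMul1Closed.Build _ (@binary_tetrahedral R)
  (@binary_tetrahedral_closed R).1.
HB.instance Definition _ := isInvClosed.Build _ (@binary_tetrahedral R)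
  (group_closedV (@binary_tetrahedral_closed R)).

Lemma octa_div (p q : unit_quat R) :
    p \in @binary_octahedral R -> q \in @binary_octahedral R ->
  p \notin inT -> q \notin inT -> p / q \in inT.
Proof.
move=> /zoctaP[/ztetraP->//|[m Om pE]] /zoctaP[/ztetraP->//|[n On qE]] _ _.
apply/ztetraP; exists (zdiv m n); first exact: (allP (allP zOO _ Om) _ On).
have -> : val (p / q) = qmul (val p) (qconj (val q)) by [].
by rewrite pE qE zcast_div -invfM r2E.
Qed.

Lemma octa_mul_in_tetra (p q : unit_quat R) :
    p \in @binary_octahedral R -> q \in @binary_octahedral R ->
  (p * q \in inT) = ((p \in inT) == (q \in inT)).
Proof.
move=> pO qO; case: (boolP (p \in inT)) => [pT|pNT]; first by rewrite gpredMl.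
case: (boolP (q \in inT)) => [qT|qNT]; first by rewrite gpredMr ?(negPf pNT).
have qVO : q^-1 \in @binary_octahedral R.
  exact: (group_closedV (@binary_octahedral_closed R)).
by rewrite -[q]invgK octa_div // gpredV.
Qed.

(** The sign character O -> O / T, with values in the subgroup generated by an
    involution s. *)
Lemma octa_sign (H : groupType) (s : H) : s * s = 1 ->
  exists f : {multiplicative Ostar R -> H},
    forall g, f g = if val g \in inT then 1 else s.
Proof.
move=> s2; pose f (g : Ostar R) := if val g \in inT then 1 else s.
have fM : {morph f : g h / g * h}.
  move=> g h; rewrite /f valM octa_mul_in_tetra ?(valP g) ?(valP h) //.
  by case: (_ \in _) (_ \in _) => -[]; rewrite ?mulg1 ?mul1g ?s2.
by exists (morphism_of fM).
Qed.

Definition zconj (n : zquat) : zquat :=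
  let: (a, b, c, d) := n in (a, - b, - c, - d)%R.

Lemma zcast_conj (t : R) n : qconj (zcast t n) = zcast t (zconj n).
Proof.
by case: n => [[[a b] c] d]; apply: quat_eq; rewrite /= ?rmorphN ?mulrN.
Qed.

Definition zsquare (n : zquat) : zquat := zdiv n (zconj n).

Lemma zcast_square (t : R) n :
  qmul (zcast t n) (zcast t n) = zcast (t * t) (zsquare n).
Proof.
have qconjK q : qconj (qconj q) = q :> quat R.
  by apply: quat_eq; rewrite //= opprK.
by rewrite -{2}[zcast t n]qconjK zcast_conj zcast_div.
Qed.

Lemma ztetra_squares : all (fun n => has (fun r => has (fun s =>
    zdiv (zsquare r) (zsquare s) == zdouble (zdouble (zdouble n)))
  ztetra) ztetra) ztetra.
Proof. by vm_compute. Qed.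

(** The elements of order 3 of T are squares and generate T; running through
    the 24 elements shows that two squares suffice. *)
Lemma Tstar_squares (t : Tstar R) : exists r s : Tstar R, t = r * r / (s * s).
Proof.
have [n Tn tE] := ztetraP _ (valP t).
have /hasP[m Tm /hasP[k Tk /eqP E]] := allP ztetra_squares _ Tn.
have tstarP l : l \in ztetra -> exists r : Tstar R, val (val r) = zcast 2^-1%R l.
  move=> Tl; have nl : qnormsq (zcast (2^-1 : R)%R l) == 1%R.
    move: Tl; rewrite mem_filter znormE => /andP[/andP[/eqP-> _] _].
    by apply/eqP; field.
  pose q : unit_quat R := Sub (zcast 2^-1%R l) nl.
  have qT : q \in inT by apply/ztetraP; exists l.
  by exists (exist (fun q => q \in inT) q qT).
have [[r rE] [s sE]] := (tstarP _ Tm, tstarP _ Tk).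
exists r, s; apply/val_inj/val_inj.
have -> : val (val (r * r / (s * s))) =
    qmul (qmul (val (val r)) (val (val r)))
         (qconj (qmul (val (val s)) (val (val s)))) by [].
rewrite rE sE !zcast_square zcast_div E !zcast_double tE.
by congr zcast; field.
Qed.

(** A square in O has trivial sign. *)
Lemma Tstar_image (f : {multiplicative Tstar R -> Ostar R}) t :
  val (f t) \in inT.
Proof.
have sq (g : Ostar R) : val (g * g) \in inT.
  by rewrite valM octa_mul_in_tetra ?(valP g).
have [r [s ->]] := Tstar_squares t.
rewrite [f _]gmulfM [f _^-1]homV ![f (_ * _)]gmulfM valM gpredMl ?sq //.
by rewrite [val _]homV gpredV sq.
Qed.

Lemma quatV (g : unit_quat R) : val g^-1 = qconj (val g).
Proof. by []. Qed.

Lemma quatM (g h : unit_quat R) : val (g * h) = qmul (val g) (val h).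
Proof. by []. Qed.

(** The square of u is an involution in the unit quaternions: being its own
    conjugate it is real, hence it is -1. *)
Lemma quat_sqrN1 (u : unit_quat R) : u * u <> 1 -> u ^+ 4 = 1 ->
  qmul (val u) (val u) = Quat (-1) 0 0 0 :> quat R.
Proof.
rewrite (expgnA u 2 2) expg2 -[qmul _ _]quatM expg2.
case: (u * u) => -[a b c d] nw.
move E : (exist _ _ _ : unit_quat R) => w w1 w2.
have wV : w = w^-1 by rewrite -[RHS]mul1g -w2 mulgK.
have [b0 c0 d0] : [/\ b = - b, c = - c & d = - d]%R.
  by have := congr1 val wV; rewrite quatV -E => -[].
have {b0} b0 : b = 0%R by lra.
have {c0} c0 : c = 0%R by lra.
have {d0} d0 : d = 0%R by lra.
subst b c d; have := eqP nw; rewrite /qnormsq /= => n1.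
have : ((a - 1) * (a + 1) = 0)%R by lra.
move/eqP; rewrite mulf_eq0 => /orP[] /eqP a1; last first.
  by rewrite -E /=; congr Quat; lra.
by case: w1; rewrite -E; apply/val_inj/quat_eq => //=; lra.
Qed.

(** The root is X = (1 + u) / sqrt 2.  As u^2 = -1, u is purely imaginary, and
    an element of T with real part 0 is one of +-i, +-j, +-k, so X lies in O;
    the real part 1 / sqrt 2 of X does not occur in T.  Since the inverses of
    u and X are -u and (1 - u) / sqrt 2, what inverts u also inverts X. *)
Lemma octa_sqrt (u : unit_quat R) :
    u \in inT -> qmul (val u) (val u) = Quat (-1) 0 0 0 ->
  exists X : unit_quat R, [/\ X \in @binary_octahedral R, X \notin inT,
    X * X = u & forall v, u ^ v^-1 = u^-1 -> X ^ v^-1 = X^-1].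
Proof.
case: u => -[a b c d] nu uT /= [uu _ _ _].
have n1 : (a ^+ 2 + b ^+ 2 + c ^+ 2 + d ^+ 2 = 1)%R by exact: eqP nu.
have a0 : a = 0%R by apply/eqP; rewrite -sqrf_eq0; apply/eqP; nra.
subst a; pose h : R := ((Num.sqrt 2)^-1)%R.
have h2 : (h * h = 2^-1)%R by rewrite -invfM r2E.
have nX : qnormsq (Quat h (h * b) (h * c) (h * d)) == 1%R.
  apply/eqP; rewrite /qnormsq /=.
  transitivity (h * h * (1 + (0 ^+ 2 + b ^+ 2 + c ^+ 2 + d ^+ 2)))%R.
    by ring.
  by rewrite n1 h2; field.
exists (Sub (Quat h (h * b) (h * c) (h * d))%R nX); split.
- apply/orP; right; rewrite /= !inE eqxx orbT /=.
  have coord t : t \in [:: 0; 1; -1]%R -> (h * t)%R \in [:: 0; h; - h]%R.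
    by rewrite !inE => /or3P[] /eqP->; rewrite ?mulr0 ?mulr1 ?mulrN1 eqxx ?orbT.
  case/orP: uT => /= /and5P[a01 b01 c01 d01 _].
    by move: (coord _ b01) (coord _ c01) (coord _ d01); rewrite !inE => -> -> ->.
  (* The real part 0 excludes the 16 elements with coordinates +-1/2. *)
  exfalso; move: a01; rewrite !inE => /orP[] /eqP; lra.
- apply/negP => /orP[] /= /and5P[+ _ _ _ _]; rewrite !inE.
    by case/or3P => /eqP hE; move: h2; rewrite hE; lra.
  by case/orP => /eqP hE; move: h2; rewrite hE; lra.
- have n1h := congr1 ( *%R (h * h)) n1.
  have h2M t : (h * h * t = 2^-1 * t)%R by rewrite h2.
  by apply/val_inj/quat_eq => /=;
    [|move: (h2M b)|move: (h2M c)|move: (h2M d)]; lra.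
- move=> v uJ; apply: (mulIg v); move: (congr1 (fun g => g * v) uJ).
  rewrite !conjgE !invgK -!mulgA mulVg !mulg1 => /(congr1 val).
  case: v {uJ} => -[v0 v1 v2 v3] nv [] E0 E1 E2 E3.
  by apply/val_inj/quat_eq => /=; [move: E0|move: E1|move: E2|move: E3]
    => /(congr1 ( *%R h)) E; lra.
Qed.

Lemma Ostar_sqrt (f : {multiplicative Tstar R -> Ostar R}) (p r : Tstar R) :
    injective f -> p * p <> 1 -> p ^+ 4 = 1 -> p ^ r^-1 = p^-1 ->
  exists X : Ostar R, [/\ val X \notin inT, X * X = f p &
    X ^ (f r)^-1 = X^-1].
Proof.
move=> f_inj p2 p4 pr.
have u2 : val (f p) * val (f p) <> 1.
  by move=> E; apply/p2/f_inj/val_inj; rewrite [f _]gmulfM valM E hom1.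
have u4 : val (f p) ^+ 4 = 1 by rewrite -[LHS]homX -[f p ^+ 4]homX p4 !hom1.
have [X [XO XT X2 XJ]] := octa_sqrt (Tstar_image f p) (quat_sqrN1 u2 u4).
exists (exist (fun q => q \in @binary_octahedral R) X XO).
split=> //; first exact/val_inj.
apply/val_inj/XJ.
by have := congr1 (val \o f) pr; rewrite /= !conjgE !(gmulfM, homV).
Qed.

End Octahedral.

Lemma Tstar_quaternion (R : realType) : exists p r : Tstar R,
  [/\ p * p <> 1, p ^+ 4 = 1, r * r = p * p & p ^ r^-1 = p^-1].
Proof.
have ni : qnormsq (Quat 0 1 0 0 : quat R)%R == 1%R.
  by apply/eqP; rewrite /qnormsq /=; ring.
have nj : qnormsq (Quat 0 0 1 0 : quat R)%R == 1%R.
  by apply/eqP; rewrite /qnormsq /=; ring.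
pose ui : unit_quat R := Sub (Quat 0 1 0 0)%R ni.
pose uj : unit_quat R := Sub (Quat 0 0 1 0)%R nj.
have Ti : ui \in @binary_tetrahedral R.
  by apply/orP; left; rewrite /= !inE !eqxx !orbT.
have Tj : uj \in @binary_tetrahedral R.
  by apply/orP; left; rewrite /= !inE !eqxx !orbT.
exists (exist (fun q => q \in @binary_tetrahedral R) ui Ti).
exists (exist (fun q => q \in @binary_tetrahedral R) uj Tj).
split.
- by move=> /(congr1 (fun t : Tstar R => qr (val (val t)))) /=; lra.
- rewrite (expgnA _ 2 2) !expg2.
  by apply/val_inj/val_inj/quat_eq => /=; ring.
- by apply/val_inj/val_inj/quat_eq => /=; ring.
- by apply/val_inj/val_inj/quat_eq => /=; ring.
Qed.

(** * Subgroups isomorphic to a given group *)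

Section ImageSubgroup.
Variables (K G : groupType) (F : {multiplicative K -> G}).

Definition image_pred : {pred G} := fun g => `[< exists k, F k = g >].

Lemma image_pred_closed : group_closed image_pred.
Proof.
split=> [|g h]; first by apply/asboolP; exists 1; rewrite hom1.
move=> /asboolP[k <-] /asboolP[l <-]; apply/asboolP.
by exists (k / l); rewrite gmulfM homV.
Qed.

Definition image_subgroup := {g : G | image_pred g}.

HB.instance Definition _ := SubChoice.on image_subgroup.
HB.instance Definition _ := SubChoice_isSubGroup.Build G
  image_pred image_subgroup image_pred_closed.

Lemma image_subgroup_isomorphic :
  injective F -> isomorphic K image_subgroup.
Proof.
move=> F_inj.
have FP k : image_pred (F k) by apply/asboolP; exists k.
pose f k : image_subgroup := exist _ (F k) (FP k).
have fM : {morph f : x y / x * y}.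
  by move=> x y; apply/val_inj; rewrite valM /= gmulfM.
exists (morphism_of fM).
have /choice[g gP] : forall h : image_subgroup, exists k, f k = h.
  by case=> h hP; have /asboolP[k kP] := hP; exists k; apply/val_inj.
exists g => x; last exact: gP.
by apply: F_inj; have := congr1 val (gP (f x)).
Qed.

End ImageSubgroup.

(** * The embedding of K2 *)

Theorem proposition77 (R : realType)
    (i j : {multiplicative Tstar R -> Ostar R})
    (i_inj : injective i) (j_inj : injective j)
    (G : groupType) (G_iso : isomorphic G (amalgam i j)) :
  exists (S : {pred G}) (H : subGroupType S), isomorphic K2 H.
Proof.
suff [F F_inj] : exists F : {multiplicative K2 -> amalgam i j}, injective F.
  have [phi [psi phiK psiK]] := G_iso.
  have FM : {morph psi \o F : x y / x * y}.
    by move=> x y /=; rewrite [F _]gmulfM (can2_gmulfM phiK psiK).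
  exists (image_pred (morphism_of FM)), (image_subgroup (morphism_of FM)).
  by apply: image_subgroup_isomorphic; apply/inj_comp/F_inj/(can_inj psiK).
have [p [r [p2 p4 r2 pJr]]] := Tstar_quaternion R.
have k2 := quaternion_third_sqr r2 pJr.
have [X [XT X2 XJ]] := Ostar_sqrt i_inj p2 p4 pJr.
have [|||W [WT W2 WJ]] := @Ostar_sqrt _ j (r / p) p j_inj _ _ _.
- by rewrite k2.
- by rewrite (expgnA _ 2 2) expg2 (expg2 (_ / _)) k2 -!expg2 -expgnA.
- by rewrite conjgE invgK invgF -(mulgA r) -invgM -r2 invgM mulVKg.
have [fA fAE] := octa_sign R (reflection_sqr (-1)%R).
have [fB fBE] := octa_sign R (reflection_sqr 1%R).
have [c|D [DA DB]] := @amalgam_lift _ _ _ i j _ fA fB.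
  by rewrite fAE fBE !Tstar_image.
have glued_inj := inj_comp (amalgam_inl_inj i_inj j_inj) i_inj.
apply: (K2_embeds (amalgam_glue i j) p2 p4 r2 pJr X2 XJ W2 WJ glued_inj (D := D)).
- by move=> c; rewrite DA fAE Tstar_image.
- by rewrite DA fAE (negPf XT).
- by rewrite DB fBE (negPf WT).
Qed.
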